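(* Let $\hat{v}\in\mathbb{C}^{3N}$ be a given solution to the load-flow equations for a vector of power injections $\hat{s}\in\mathbb{C}^{6N}$. Let $s\in\mathbb{C}^{6N}$ be another vector of power injections, and assume that there exists $\rho\in(0,\gamma(\hat v))$ such that $$\frac{\xi^Y(s-\hat s)+\frac{\xi^Y(\hat s)}{\alpha(\hat v)}\rho}{\alpha(\hat v)-\rho}+\frac{\xi^\Delta(s-\hat s)+\frac{\xi^\Delta(\hat s)}{\beta(\hat v)}\rho}{\beta(\hat v)-\rho}\le\rho$$ and $$\frac{\xi^Y(s)}{(\alpha(\hat v)-\rho)^2}+\frac{\xi^\Delta(s)}{(\beta(\hat v)-\rho)^2}<1 .$$ Then there exists a unique solution $v$ in $$\mathcal{D}_\rho(\hat v)=\{v\in\mathbb{C}^{3N}:\ |(v)_j-(\hat v)_j|\le\rho\,|(w)_j|,\ j=1,\dots,3N\}$$ to the load-flow equations with power injection $s$. Moreover, for every initial point $v^{(0)}\in\mathcal{D}_\rho(\hat v)$, the iteration $v^{(k+1)}=G_s(v^{(k)})$ converges to this solution $v$.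
   Context: Network data. Let $N\ge 1$ be an integer (number of three-phase $PQ$ buses). Let $Y_{L0}\in\mathbb{C}^{3N\times 3}$ and $Y_{LL}\in\mathbb{C}^{3N\times 3N}$ be the blocks of the three-phase admittance matrix $Y=\begin{pmatrix}Y_{00}&Y_{0L}\\ Y_{L0}&Y_{LL}\end{pmatrix}\in\mathbb{C}^{3(N+1)\times 3(N+1)}$, and let $v_0\in\mathbb{C}^3$ be the (fixed, known) slack-bus voltage vector. It is assumed that $Y_{LL}$ is invertible. Put $w:=-Y_{LL}^{-1}Y_{L0}v_0\in\mathbb{C}^{3N}$ (zero-load voltage); all entries of $w$ are assumed nonzero. Put $W:=\mathrm{diag}(w)$. Let $H\in\mathbb{R}^{3N\times 3N}$ be the block-diagonal matrix with $N$ diagonal blocks all equal to $$\Gamma=\begin{pmatrix}1&-1&0\\0&1&-1\\-1&0&1\end{pmatrix},$$ and let $L:=|H|$ be its entrywise absolute value. Conventions. $|\cdot|$ of a vector or matrix is entrywise; $\overline{\,\cdot\,}$ is (entrywise) complex conjugation; $^{\mathsf T}$ is transposition; $\mathrm{diag}(x)$ is the diagonal matrix with diagonal $x$; $\|A\|_\infty=\max_i\sum_j|A_{ij}|$ for a complex matrix $A$; $(x)_j$ is the $j$-th entry of $x$. A vector of power injections is $s=((s^Y)^{\mathsf T},(s^\Delta)^{\mathsf T})^{\mathsf T}\in\mathbb{C}^{6N}$ with $s^Y,s^\Delta\in\mathbb{C}^{3N}$. Load-flow equations. A vector $v\in\mathbb{C}^{3N}$ is a solution to the load-flow equations with power injection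 $s$ if there are $i,i^\Delta\in\mathbb{C}^{3N}$ such that $$\mathrm{diag}(H^{\mathsf T}\overline{i^\Delta})\,v+s^Y=\mathrm{diag}(v)\,\overline{i},\qquad s^\Delta=\mathrm{diag}(Hv)\,\overline{i^\Delta},\qquad i=Y_{L0}v_0+Y_{LL}v .$$ When all entries of $v$ and of $Hv$ are nonzero this is written as the fixed-point equation $v=G_s(v)$, where $$G_s(v):=w+Y_{LL}^{-1}\left(\mathrm{diag}(\overline v)^{-1}\,\overline{s^Y}+H^{\mathsf T}\,\mathrm{diag}(H\overline v)^{-1}\,\overline{s^\Delta}\right).$$ Quantities. For $s\in\mathbb{C}^{6N}$: $$\xi^Y(s):=\|W^{-1}Y_{LL}^{-1}W^{-1}\mathrm{diag}(s^Y)\|_\infty,\qquad \xi^\Delta(s):=\|W^{-1}Y_{LL}^{-1}H^{\mathsf T}\mathrm{diag}(L|w|)^{-1}\mathrm{diag}(s^\Delta)\|_\infty .$$ For $v\in\mathbb{C}^{3N}$: $$\alpha(v):=\min_j\frac{|(v)_j|}{|(w)_j|},\qquad \beta(v):=\min_j\frac{|(Hv)_j|}{(L|w|)_j},\qquad \gamma(v):=\min\{\alpha(v),\beta(v)\},$$ with $j$ ranging over $1,\dots,3N$. *)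

(* Defs.v *)
(* The complex numbers are R[i] over an arbitrary R : realType. *)
From HB Require Import structures.
From mathcomp Require Import all_boot all_order all_algebra.
From mathcomp Require Import all_classical all_reals all_analysis.
From mathcomp Require Import complex.

Set Implicit Arguments.
Unset Strict Implicit.
Unset Printing Implicit Defensive.

Import Order.TTheory GRing.Theory Num.Theory.
Import numFieldNormedType.Exports.

Local Open Scope classical_set_scope.
Local Open Scope ring_scope.
Local Open Scope complex_scope.

(* The real-valued modulus [Normc.normc] is used throughout, because `|z| is
   itself an element of R[i]. *)

Definition diagc (T : pzRingType) n (x : 'cV[T]_n) : 'M[T]_n := diag_mx x^T.

Definition conjv (R : realType) n (x : 'cV[R[i]]_n) : 'cV[R[i]]_n :=
  map_mx (fun z => z^*) x.

Definition absv (R : realType) n (x : 'cV[R[i]]_n) : 'cV[R]_n :=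
  map_mx (@Normc.normc R) x.

Definition complex_mx (R : realType) m n (A : 'M[R]_(m, n)) : 'M[R[i]]_(m, n) :=
  map_mx (real_complex R) A.

Definition norm_oo (R : realType) m n (A : 'M[R[i]]_(m, n)) : R :=
  \big[Num.max/0]_i \sum_j Normc.normc (A i j).

(* The value 0 at n = 0 is junk; see [min_indexP] for n > 0. *)
Definition min_index (R : realType) n (f : 'I_n -> R) : R :=
  if [pick j : 'I_n] is Some j0 then \big[Num.min/f j0]_j f j else 0.

Lemma min_indexP (R : realType) n (f : 'I_n -> R) : (0 < n)%N ->
  (forall j, min_index f <= f j) /\ (exists j, min_index f = f j).
Proof.
move=> n0; rewrite /min_index; case: pickP => [j0 _|/(_ (Ordinal n0))//].
split=> [j|]; first by rewrite (bigD1 j) //= ge_min lexx.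
elim/big_ind: _ => [|x y [i ->] [j ->]|i _]; [by exists j0| |by exists i].
by case: (leP (f i) (f j)) => _; [exists i|exists j].
Qed.

(* Convergence for the product topology on C^n. MathComp-Analysis puts the
   topology given by the modulus on the alias R[i]^o rather than on R[i]. *)
Definition cvg_vec (R : realType) n (u : nat -> 'cV[R[i]]_n)
    (v : 'cV[R[i]]_n) : Prop :=
  (u : nat -> 'cV[R[i]^o]_n) @ \oo --> (v : 'cV[R[i]^o]_n).

Definition Gamma_mx (R : realType) : 'M[R]_3 :=
  \matrix_(i, j) (nth [::] [:: [::  1; -1;  0];
                               [::  0;  1; -1];
                               [:: -1;  0;  1]] i)`_j.

(* Coordinate i of C^{3N} is phase i %% 3 at bus i %/ 3. *)
Definition H_mx (R : realType) (N : nat) : 'M[R]_(3 * N) :=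
  \matrix_(i, j) if (i %/ 3 == j %/ 3)%N
                 then Gamma_mx R (inord (i %% 3)) (inord (j %% 3)) else 0.

Definition L_mx (R : realType) (N : nat) : 'M[R]_(3 * N) :=
  map_mx (fun x : R => `|x|) (H_mx R N).

Definition HC (R : realType) (N : nat) : 'M[R[i]]_(3 * N) :=
  complex_mx (H_mx R N).

Definition Y_L0 (R : realType) (N : nat) (Y : 'M[R[i]]_(3 + 3 * N)) :
  'M[R[i]]_(3 * N, 3) := dlsubmx Y.

Definition Y_LL (R : realType) (N : nat) (Y : 'M[R[i]]_(3 + 3 * N)) :
  'M[R[i]]_(3 * N) := drsubmx Y.

Definition zero_load (R : realType) (N : nat) (Y : 'M[R[i]]_(3 + 3 * N))
    (v0 : 'cV[R[i]]_3) : 'cV[R[i]]_(3 * N) :=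
  - (invmx (Y_LL Y) *m Y_L0 Y *m v0).

(* A power injection is a vector of C^{3N + 3N}: wye part, then delta part. *)
Definition sY (R : realType) (N : nat) (s : 'cV[R[i]]_(3 * N + 3 * N)) :
  'cV[R[i]]_(3 * N) := usubmx s.

Definition sDelta (R : realType) (N : nat) (s : 'cV[R[i]]_(3 * N + 3 * N)) :
  'cV[R[i]]_(3 * N) := dsubmx s.

Definition load_flow (R : realType) (N : nat) (Y : 'M[R[i]]_(3 + 3 * N))
    (v0 : 'cV[R[i]]_3) (s : 'cV[R[i]]_(3 * N + 3 * N))
    (v : 'cV[R[i]]_(3 * N)) : Prop :=
  exists i iDelta : 'cV[R[i]]_(3 * N),
    [/\ diagc ((HC R N)^T *m conjv iDelta) *m v + sY s = diagc v *m conjv i,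
        sDelta s = diagc (HC R N *m v) *m conjv iDelta
      & i = Y_L0 Y *m v0 + Y_LL Y *m v].

Definition G_defined (R : realType) (N : nat) (v : 'cV[R[i]]_(3 * N)) : Prop :=
  forall j, v j ord0 != 0 /\ (HC R N *m v) j ord0 != 0.

(* Meaningful only under [G_defined v]: invmx is the identity on
   noninvertible matrices. *)
Definition G_map (R : realType) (N : nat) (Y : 'M[R[i]]_(3 + 3 * N))
    (v0 : 'cV[R[i]]_3) (s : 'cV[R[i]]_(3 * N + 3 * N))
    (v : 'cV[R[i]]_(3 * N)) : 'cV[R[i]]_(3 * N) :=
  zero_load Y v0 + invmx (Y_LL Y) *m
    (invmx (diagc (conjv v)) *m conjv (sY s)
     + (HC R N)^T *m invmx (diagc (HC R N *m conjv v)) *m conjv (sDelta s)).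

Definition L_abs_w (R : realType) (N : nat) (Y : 'M[R[i]]_(3 + 3 * N))
    (v0 : 'cV[R[i]]_3) : 'cV[R]_(3 * N) :=
  L_mx R N *m absv (zero_load Y v0).

Definition xiY (R : realType) (N : nat) (Y : 'M[R[i]]_(3 + 3 * N))
    (v0 : 'cV[R[i]]_3) (s : 'cV[R[i]]_(3 * N + 3 * N)) : R :=
  let W := diagc (zero_load Y v0) in
  norm_oo (invmx W *m invmx (Y_LL Y) *m invmx W *m diagc (sY s)).

Definition xiDelta (R : realType) (N : nat) (Y : 'M[R[i]]_(3 + 3 * N))
    (v0 : 'cV[R[i]]_3) (s : 'cV[R[i]]_(3 * N + 3 * N)) : R :=
  let W := diagc (zero_load Y v0) in
  norm_oo (invmx W *m invmx (Y_LL Y) *m (HC R N)^T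
           *m invmx (diagc (complex_mx (L_abs_w Y v0))) *m diagc (sDelta s)).

Definition alpha (R : realType) (N : nat) (Y : 'M[R[i]]_(3 + 3 * N))
    (v0 : 'cV[R[i]]_3) (v : 'cV[R[i]]_(3 * N)) : R :=
  min_index (fun j => absv v j ord0 / absv (zero_load Y v0) j ord0).

Definition beta (R : realType) (N : nat) (Y : 'M[R[i]]_(3 + 3 * N))
    (v0 : 'cV[R[i]]_3) (v : 'cV[R[i]]_(3 * N)) : R :=
  min_index (fun j => absv (HC R N *m v) j ord0 / L_abs_w Y v0 j ord0).

Definition gamma (R : realType) (N : nat) (Y : 'M[R[i]]_(3 + 3 * N))
    (v0 : 'cV[R[i]]_3) (v : 'cV[R[i]]_(3 * N)) : R :=
  Num.min (alpha Y v0 v) (beta Y v0 v).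

Definition D_set (R : realType) (N : nat) (Y : 'M[R[i]]_(3 + 3 * N))
    (v0 : 'cV[R[i]]_3) (rho : R) (vhat : 'cV[R[i]]_(3 * N)) :
    set 'cV[R[i]]_(3 * N) :=
  [set v | forall j, absv (v - vhat) j ord0
                     <= rho * absv (zero_load Y v0) j ord0].

(* Main.v *)
(* In the norm max_j |x_j| / |w_j| the set D_rho(vhat) is a closed ball. On it,
   |v_j| >= (alpha - rho) |w_j| and |(Hv)_j| >= (beta - rho) (L|w|)_j, so that
   1/x - 1/y = (y - x)/(xy) turns xi^Y(s) and xi^Delta(s) into a Lipschitz
   constant of G_s, which is the left-hand side of the second assumption. As vhat
   is a fixed point of G_shat, splitting
     G_s(v) - vhat = (G_s(v) - G_shat(v)) + (G_shat(v) - G_shat(vhat))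
   bounds it by the left-hand side of the first assumption, so G_s maps the ball
   to itself and Banach's fixed-point argument applies. *)
Require Import Defs.
From HB Require Import structures.
From mathcomp Require Import all_boot all_order all_algebra.
From mathcomp Require Import all_classical all_reals all_analysis.
From mathcomp Require Import complex ring.

Set Implicit Arguments.
Unset Strict Implicit.
Unset Printing Implicit Defensive.

Import Order.TTheory GRing.Theory Num.Theory.
Import numFieldNormedType.Exports.

Local Open Scope classical_set_scope.
Local Open Scope ring_scope.
Local Open Scope complex_scope.
Local Notation nc := (Normc.normc).

(** * Elementary properties of the real-valued modulus *)

Lemma normc_ge0 (R : rcfType) (z : R[i]) : 0 <= nc z.
Proof. by case: z => a b; exact: sqrtr_ge0. Qed.

Lemma normcD (R : rcfType) (x y : R[i]) : nc (x + y) <= nc x + nc y.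
Proof. exact: (@le_normcD R x y). Qed.

Lemma normcN (R : rcfType) (x : R[i]) : nc (- x) = nc x.
Proof. exact: (@complex.normcN R x). Qed.

Lemma normc_distC (R : rcfType) (x y : R[i]) : nc (x - y) = nc (y - x).
Proof. by rewrite -normcN opprB. Qed.

Lemma normc_distD (R : rcfType) (z x y : R[i]) :
  nc (x - y) <= nc (x - z) + nc (z - y).
Proof. by rewrite -{1}[x](subrK z) -addrA normcD. Qed.

Lemma normc_sum (R : rcfType) (I : finType) (f : I -> R[i]) :
  nc (\sum_i f i) <= \sum_i nc (f i).
Proof.
elim/big_ind2: _ => [|x a y b xa yb|//]; first by rewrite Normc.normc0.
by rewrite (le_trans (normcD _ _)) ?lerD.
Qed.

Lemma normc_conj (R : rcfType) (z : R[i]) : nc z^* = nc z.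
Proof. by case: z => a b; rewrite /= sqrrN. Qed.

Lemma normc_real (R : rcfType) (x : R) : nc x%:C = `|x|.
Proof. by rewrite /= expr0n addr0 sqrtr_sqr. Qed.

Lemma normc_eq0 (R : rcfType) (z : R[i]) : (nc z == 0) = (z == 0).
Proof. by apply/eqP/eqP => [/Normc.eq0_normc//|->]; rewrite Normc.normc0. Qed.

Lemma normc_gt0 (R : rcfType) (z : R[i]) : (0 < nc z) = (z != 0).
Proof. by rewrite lt0r normc_ge0 normc_eq0 andbT. Qed.

Lemma normc_ge_abs_Re (R : rcfType) (z : R[i]) : `|complex.Re z| <= nc z.
Proof.
case: z => a b /=; rewrite -sqrtr_sqr ler_wsqrtr// lerDl; exact: sqr_ge0.
Qed.

Lemma normc_ge_abs_Im (R : rcfType) (z : R[i]) : `|complex.Im z| <= nc z.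
Proof.
case: z => a b /=; rewrite -sqrtr_sqr ler_wsqrtr// lerDr; exact: sqr_ge0.
Qed.

Lemma normc_le_abs_Re_Im (R : rcfType) (z : R[i]) :
  nc z <= `|complex.Re z| + `|complex.Im z|.
Proof.
case: z => a b /=; rewrite -(@ger0_norm _ (`|a| + `|b|)) ?addr_ge0//.
rewrite -[leRHS]sqrtr_sqr ler_wsqrtr// sqrrD !real_normK ?num_real// addrAC lerDl.
by rewrite mulrn_wge0 // mulr_ge0.
Qed.

(** * Limits of geometrically Cauchy real and complex sequences *)

Section Geometric.
Variable R : realType.

Lemma le_of_geometric (q C x y : R) : 0 <= q < 1 ->
  (forall k, x <= y + q ^+ k * C) -> x <= y.
Proof.
move=> /andP[q0 q1] h.
have cv : (fun k => y + q ^+ k * C) @ \oo --> y + 0 * C.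
  apply: cvgD; first exact: cvg_cst.
  by apply: cvgM; [apply: cvg_expr; rewrite ger0_norm|exact: cvg_cst].
rewrite mul0r addr0 in cv.
by apply: (ler_cvg_to (cvg_cst x) cv); exact: nearW.
Qed.

(** By order completeness, the supremum of the left ends of the intervals of radius [q ^+ k * C]
    around [r k] lies in all of them, so the rate comes with the limit. *)
Lemma real_geometric_cauchy (r : nat -> R) (q C : R) : 0 <= q -> 0 <= C ->
  (forall k m, `|r (m + k)%N - r k| <= q ^+ k * C) ->
  exists x, forall k, `|r k - x| <= q ^+ k * C.
Proof.
move=> q0 C0 h.
have C'0 k : 0 <= q ^+ k * C by rewrite mulr_ge0 ?exprn_ge0.
have lu k m : r k - q ^+ k * C <= r m + q ^+ m * C.
  have [km|/ltnW mk] := leqP k m.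
    have := h k (m - k)%N; rewrite subnK// ler_distl => /andP[+ _] => rkm.
    by rewrite (le_trans rkm) // lerDl.
  have := h m (k - m)%N; rewrite subnK// ler_distl => /andP[_ rkm].
  by rewrite (le_trans _ rkm) // lerBlDr lerDl.
(* The intervals [r k - q ^+ k * C, r k + q ^+ k * C] pairwise meet. *)
pose S := range (fun k => r k - q ^+ k * C).
exists (sup S) => k; rewrite distrC ler_distl; apply/andP; split.
  apply: ub_le_sup; last by exists k.
  by exists (r 0%N + q ^+ 0 * C) => _ [m _ <-].
by apply: ge_sup => [|_ [m _ <-]//]; exists (r 0%N - q ^+ 0 * C); exists 0%N.
Qed.

(** Real and imaginary parts have limits separately; recombining them through |z| <= |Re z| + |Im z|
    costs the factor 2. *)
Lemma complex_geometric_cauchy (a : nat -> R[i]) (q C : R) : 0 <= q -> 0 <= C ->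
  (forall k m, nc (a (m + k)%N - a k) <= q ^+ k * C) ->
  exists z, forall k, nc (a k - z) <= q ^+ k * (2 * C).
Proof.
move=> q0 C0 h.
have [x hx] : exists x, forall k, `|complex.Re (a k) - x| <= q ^+ k * C.
  apply: real_geometric_cauchy => // k m; apply: le_trans (h k m).
  by rewrite -raddfB normc_ge_abs_Re.
have [y hy] : exists y, forall k, `|complex.Im (a k) - y| <= q ^+ k * C.
  apply: real_geometric_cauchy => // k m; apply: le_trans (h k m).
  by rewrite -raddfB normc_ge_abs_Im.
exists (x +i* y) => k; apply: le_trans (normc_le_abs_Re_Im _) _.
rewrite !raddfB /= mulrCA mulr_natl mulr2n; exact: lerD.
Qed.

End Geometric.

(** * Banach's fixed-point argument on a weighted sup-norm ball *)

Section WeightedContraction.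
Variables (R : realType) (n : nat).

(* The ball of radius t for max_j |x_j| / c_j, also meaningful when c_j = 0. *)
Definition wball (c : 'I_n -> R) (p : 'cV[R[i]]_n) (t : R) : set 'cV[R[i]]_n :=
  [set v | forall j, nc ((v - p) j ord0) <= t * c j].

Variables (c : 'I_n -> R) (p : 'cV[R[i]]_n) (rho q : R).
Variable F : 'cV[R[i]]_n -> 'cV[R[i]]_n.
Hypotheses (c0 : forall j, 0 <= c j) (rho0 : 0 <= rho) (q01 : 0 <= q < 1).
Hypothesis Fself : forall v, wball c p rho v -> wball c p rho (F v).
(** Phrasing the Lipschitz condition by membership in balls avoids defining the weighted distance as
    a maximum of quotients. *)
Hypothesis Flip : forall t u v, wball c p rho u -> wball c p rho v -> 0 <= t ->
  wball c v t u -> wball c (F v) (q * t) (F u).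

Lemma wball_sym u v t : wball c v t u -> wball c u t v.
Proof. by move=> h j; have := h j; rewrite !mxE normc_distC. Qed.

Lemma wball_trans u v x t t' :
  wball c v t u -> wball c x t' v -> wball c x (t + t') u.
Proof.
move=> h h' j; have := h j; have := h' j; rewrite !mxE => hj' hj.
by apply: le_trans (normc_distD (v j ord0) _ _) _; rewrite mulrDl lerD.
Qed.

Lemma wball_iter k u : wball c p rho u -> wball c p rho (iter k F u).
Proof. by move=> hu; elim: k => //= k; exact: Fself. Qed.

(** The constant [2 * rho] bounds the distance of two points of the ball, measured through its
    centre; each application of [F] then gains a factor [q]. *)
Lemma iter_contraction k u v : wball c p rho u -> wball c p rho v ->
  wball c (iter k F v) (q ^+ k * (2 * rho)) (iter k F u).
Proof.
move=> hu hv; case/andP: q01 => q0 _; elim: k => [|k IH] /=.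
  rewrite expr0 mul1r mulr_natl mulr2n; apply: wball_trans hu _.
  exact: wball_sym.
rewrite exprS -mulrA; apply: Flip => //; try exact: wball_iter.
by rewrite !mulr_ge0 ?exprn_ge0.
Qed.

(** Stands in for closedness of balls: an estimate obtained through the [k]-th iterate passes to the
    limit without any topology. *)
Lemma le_wball_geometric u v t C :
  (forall k, wball c v (t + q ^+ k * C) u) -> wball c v t u.
Proof.
move=> h j; apply: (@le_of_geometric _ q (C * c j)) => // k.
by rewrite mulrA -mulrDl; exact: h.
Qed.

Lemma wball0 u v : wball c v 0 u -> u = v.
Proof.
move=> h; apply/colP => j; have := h j; rewrite mul0r => hj.
apply/eqP; rewrite -subr_eq0 -normc_eq0 eq_le normc_ge0 andbT.
by move: hj; rewrite !mxE.
Qed.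

(** The fixed point is the limit of the orbit of the centre [p]. The rate is stated for every
    starting point, so that it gives convergence and, when the starting point is itself fixed,
    uniqueness. *)
Lemma weighted_contraction : exists v,
  [/\ wball c p rho v, F v = v & forall k u, wball c p rho u ->
      wball c v (q ^+ k * (2 * rho)) (iter k F u)].
Proof.
have /andP[q0 q1] := q01.
have hp : wball c p rho p.
  by move=> j; rewrite subrr mxE Normc.normc0 mulr_ge0.
(* Comparing the orbits of [iter m F p] and [p] after [k] steps gives the Cauchy bound without
   summing a geometric series. *)
have cau j k m : nc (iter (m + k) F p j ord0 - iter k F p j ord0)
    <= q ^+ k * (2 * rho * c j).
  have := iter_contraction k (wball_iter m hp) hp j.
  by rewrite -iterD !mxE [(m + k)%N]addnC -[q ^+ k * _ * c j]mulrA.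
have /choice[z hz] : forall j, exists z : R[i], forall k,
    nc (iter k F p j ord0 - z) <= q ^+ k * (2 * (2 * rho * c j)).
  by move=> j; apply: complex_geometric_cauchy => //; rewrite !mulr_ge0.
pose v : 'cV[R[i]]_n := \col_j z j.
have hv k : wball c v (q ^+ k * (2 * (2 * rho))) (iter k F p).
  by move=> j; have := hz j k; rewrite !mxE !mulrA.
have Dv : wball c p rho v.
  apply: (@le_wball_geometric _ _ _ (2 * (2 * rho))) => k.
  by rewrite addrC; apply: wball_trans (wball_sym (hv k)) (wball_iter k hp).
(* Both [F v], by contraction, and [v] are within [q ^+ k.+1 * (2 * (2 * rho))] of
   [iter k.+1 F p]. *)
have Fv : F v = v.
  apply: wball0.
  apply: (@le_wball_geometric _ _ _
    (q * (2 * (2 * rho)) + q * (2 * (2 * rho)))) => k.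
  rewrite add0r mulrDr.
  apply: (@wball_trans _ (iter k.+1 F p)).
    rewrite mulrCA; apply: Flip => //; first exact: wball_iter.
      by rewrite !mulr_ge0 ?exprn_ge0.
    exact/wball_sym/hv.
  by rewrite mulrA -exprSr.
exists v; split=> // k u hu.
rewrite -[v in wball c v](iter_fix k Fv).
exact: iter_contraction.
Qed.

(** A neighbourhood of [v] contains a product of finitely many coordinate neighbourhoods, so
    convergence is checked entry by entry. *)
Lemma geometric_cvg_vec (u : nat -> 'cV[R[i]]_n) (v : 'cV[R[i]]_n) C :
  (forall k, wball c v (q ^+ k * C) (u k)) -> cvg_vec u v.
Proof.
move=> h A [P hP sPA].
suff : \forall k \near \oo, forall j, P j ord0 (u k j ord0).
  apply: filterS => k hk; apply: sPA => i j; rewrite (ord1 j); exact: hk.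
apply: filter_forall => j.
have /nbhs_ballP[e /= e0 he] := hP j ord0.
(* The radius [e] lies in [R[i]]; being positive, it is real and equals its real part. *)
have e0R : 0 < complex.Re e by move: e0; rewrite ltcE => /andP[].
have ce : e = (complex.Re e)%:C by rewrite RRe_real// gtr0_real.
have cv : (fun k => q ^+ k * (C * c j)) @ \oo --> 0 * (C * c j).
  case/andP: q01 => ? ?.
  by apply: cvgM; [apply: cvg_expr; rewrite ger0_norm|exact: cvg_cst].
rewrite mul0r in cv.
move/cvgr0Pnorm_lt: cv => /(_ _ e0R) cv.
near=> k; apply: he.
rewrite -ball_normE /= ce normc_def ltcR.
have := h k j; rewrite !mxE normc_distC => hk.
have lt : q ^+ k * (C * c j) < complex.Re e.
  by apply: le_lt_trans (ler_norm _) _; near: k; exact: cv.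
apply: le_lt_trans lt; rewrite mulrA.
by apply: le_trans hk; case: (v j ord0 - u k j ord0).
Unshelve. all: by end_near. Qed.

End WeightedContraction.

(** * Size and variation of conjugated quotients *)

Section Quotient.
Variable R : realType.

Lemma normc_conj_div_le (s x : R[i]) (m c : R) : 0 < m -> 0 < c ->
  m * c <= nc x -> nc (s / x)^* <= m^-1 / c * nc s.
Proof.
move=> m0 c0 hx; rewrite normc_conj Normc.normcM Normc.normcV mulrC.
rewrite ler_wpM2r ?normc_ge0// -invfM lef_pV2 ?posrE ?mulr_gt0//.
by apply: lt_le_trans hx; rewrite mulr_gt0.
Qed.

(** In 1/x - 1/y = (y - x)/(xy), one factor [c] of the lower bounds cancels against that of [t * c];
    the remaining 1/c is what the diagonal scaling in the xi-quantities absorbs. *)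
Lemma normc_conj_divB_le (s x y : R[i]) (m m' t c : R) :
  0 < m -> 0 < m' -> 0 < c -> m * c <= nc x -> m' * c <= nc y ->
  nc (x - y) <= t * c ->
  nc ((s / x)^* - (s / y)^*) <= t / (m * m') / c * nc s.
Proof.
move=> m0 m'0 c0 hx hy hxy.
have nx : 0 < nc x by apply: lt_le_trans hx; rewrite mulr_gt0.
have ny : 0 < nc y by apply: lt_le_trans hy; rewrite mulr_gt0.
have [x0 y0] : x != 0 /\ y != 0 by rewrite -!normc_gt0.
have t0 : 0 <= t.
  by rewrite -(pmulr_lge0 _ c0); apply: le_trans hxy; rewrite normc_ge0.
rewrite -rmorphB normc_conj.
have -> : s / x - s / y = s * ((y - x) / (x * y)) by field; rewrite x0 y0.
rewrite Normc.normcM mulrC ler_wpM2r ?normc_ge0//.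
rewrite Normc.normcM Normc.normcV Normc.normcM normc_distC.
rewrite ler_pdivrMr ?mulr_gt0//; apply: le_trans hxy _.
have -> : t * c = t / (m * m') / c * ((m * c) * (m' * c)).
  by field; rewrite !gt_eqF.
rewrite ler_wpM2l//; first by rewrite !divr_ge0// ?mulr_ge0// ltW.
by rewrite ler_pM// mulr_ge0// ltW.
Qed.

End Quotient.

(** * Diagonal scaling and the weighted operator norm *)

Section DiagonalScaling.
Variable R : realType.

Lemma invmx_diagc (F : fieldType) n (x : 'cV[F]_n) : (forall j, x j ord0 != 0) ->
  invmx (diagc x) = diagc (map_mx (fun z => z^-1) x).
Proof.
move=> hx.
have xv : diagc x *m diagc (map_mx (fun z => z^-1) x) = 1%:M.
  rewrite /diagc mulmx_diag -diag_const_mx; congr diag_mx.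
  by apply/rowP => j; rewrite !mxE divff.
have [ux _] := mulmx1_unit xv.
by rewrite -[RHS](mulKmx ux) xv mulmx1.
Qed.

Lemma le_norm_oo m n (A : 'M[R[i]]_(m, n)) i :
  \sum_j nc (A i j) <= norm_oo A.
Proof. exact: (le_bigmax _ (fun i => \sum_j nc (A i j))). Qed.

Lemma norm_oo_ge0 m n (A : 'M[R[i]]_(m, n)) : 0 <= norm_oo A.
Proof. exact: bigmax_ge_id. Qed.

(** The scaled matrix has entries B_jk s_k / (w_j c_k); its row sums bound (Bf)_j / w_j up to the
    factor [t]. Both xi-quantities are norms of this form. *)
Lemma normc_mulmx_le m n (B : 'M[R[i]]_(m, n)) (w : 'cV[R[i]]_m)
    (c s f : 'cV[R[i]]_n) (t : R) :
  (forall j, w j ord0 != 0) -> (forall k, c k ord0 != 0) -> 0 <= t ->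
  (forall k, nc (f k ord0) <= t / nc (c k ord0) * nc (s k ord0)) ->
  forall j, nc ((B *m f) j ord0) <=
    t * norm_oo (invmx (diagc w) *m B *m invmx (diagc c) *m diagc s)
    * nc (w j ord0).
Proof.
move=> w0 c0 t0 hf j; rewrite mxE; apply: le_trans (normc_sum _) _.
rewrite mulrAC; apply: le_trans (ler_wpM2l _ (le_norm_oo _ j)); last first.
  by rewrite mulr_ge0 ?normc_ge0.
rewrite mulr_sumr; apply: ler_sum => k _; rewrite Normc.normcM.
rewrite !invmx_diagc// /diagc mul_mx_diag mxE mul_mx_diag mxE mul_diag_mx !mxE.
apply: le_trans (ler_wpM2l (normc_ge0 _) (hf k)) _.
rewrite !Normc.normcM !Normc.normcV le_eqVlt; apply/orP; left; apply/eqP.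
by field; rewrite !normc_eq0 w0 c0.
Qed.

End DiagonalScaling.

(** * The load-flow equations as a fixed-point equation *)

Section LoadFlow.
Variables (R : realType) (N : nat).
Implicit Types Y : 'M[R[i]]_(3 + 3 * N).

(** The current produced by power [s] at voltage [y], that is, the solution i of s = diag(y) conj(i)
    when [y] has no zero entry. *)
Definition conj_quot n (s y : 'cV[R[i]]_n) : 'cV[R[i]]_n :=
  \col_k (s k ord0 / y k ord0)^*.

Lemma conjv_real_mul m n (A : 'M[R]_(m, n)) (x : 'cV[R[i]]_n) :
  conjv (complex_mx A *m x) = complex_mx A *m conjv x.
Proof.
apply/colP => j; rewrite !mxE rmorph_sum; apply: eq_bigr => k _.
by rewrite rmorphM /= !mxE conjc_real.
Qed.

Lemma conjvB n (x y : 'cV[R[i]]_n) : conjv (x - y) = conjv x - conjv y.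
Proof. by apply/colP => j; rewrite !mxE rmorphB. Qed.

Lemma colvB n (x y : 'cV[R[i]]_n) j : (x - y) j ord0 = x j ord0 - y j ord0.
Proof. by rewrite !mxE. Qed.

Lemma diagc_mulC n (x y : 'cV[R[i]]_n) : diagc x *m y = diagc y *m x.
Proof. by apply/colP => j; rewrite /diagc !mul_diag_mx !mxE mulrC. Qed.

Lemma conj_quotP n (s y x : 'cV[R[i]]_n) : (forall k, y k ord0 != 0) ->
  s = diagc y *m conjv x <-> x = conj_quot s y.
Proof.
move=> hy; split=> ->; apply/colP => k; rewrite /diagc !mul_diag_mx !mxE.
  by rewrite [_ * _^*]mulrC mulfK// conjcK.
by rewrite conjcK mulrC divfK.
Qed.

Lemma HC_tr : (HC R N)^T = complex_mx (H_mx R N)^T.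
Proof. by rewrite /HC /complex_mx map_trmx. Qed.

Lemma invmx_diagc_conjv n (y s : 'cV[R[i]]_n) : (forall k, y k ord0 != 0) ->
  invmx (diagc (conjv y)) *m conjv s = conj_quot s y.
Proof.
move=> hy; rewrite invmx_diagc => [|j]; last by rewrite mxE conjc_eq0.
apply/colP => j; rewrite /diagc mul_diag_mx !mxE mulrC rmorphM /=.
by rewrite conjc_inv.
Qed.

Lemma G_mapE Y (v0 : 'cV[R[i]]_3) (s : 'cV[R[i]]_(3 * N + 3 * N))
    (v : 'cV[R[i]]_(3 * N)) : G_defined v ->
  G_map Y v0 s v = zero_load Y v0 + invmx (Y_LL Y) *m conj_quot (sY s) v
    + (invmx (Y_LL Y) *m (HC R N)^T) *m conj_quot (sDelta s) (HC R N *m v).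
Proof.
move=> hv; rewrite /G_map mulmxDr addrA -!mulmxA.
rewrite invmx_diagc_conjv => [|k]; last by case: (hv k).
rewrite -conjv_real_mul invmx_diagc_conjv// => k; by case: (hv k).
Qed.

(** Each equation is solved for one unknown: the delta equation for the delta current, the wye
    equation for i, and the admittance equation for [v] by inverting [Y_LL]. Substitution leaves
    [G_map]. *)
Lemma load_flow_fixed_point Y (v0 : 'cV[R[i]]_3) (s : 'cV[R[i]]_(3 * N + 3 * N))
    (v : 'cV[R[i]]_(3 * N)) : Y_LL Y \in unitmx -> G_defined v ->
  load_flow Y v0 s v <-> G_map Y v0 s v = v.
Proof.
move=> uY hv; rewrite G_mapE//.
have uE i : i = Y_L0 Y *m v0 + Y_LL Y *m v <->
    zero_load Y v0 + invmx (Y_LL Y) *m i = v.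
  split=> [->|<-].
    by rewrite mulmxDr mulKmx// /zero_load !mulmxA addrA addNr add0r.
  rewrite mulmxDr mulKVmx// /zero_load mulmxN !mulmxA mulmxV// mul1mx addrA.
  by rewrite subrr add0r.
pose iD := conj_quot (sDelta s) (HC R N *m v).
pose i0 := conj_quot (sY s) v + (HC R N)^T *m iD.
have hi0 : zero_load Y v0 + invmx (Y_LL Y) *m conj_quot (sY s) v +
   (invmx (Y_LL Y) *m (HC R N)^T) *m iD = zero_load Y v0 + invmx (Y_LL Y) *m i0.
  by rewrite mulmxDr addrA mulmxA.
rewrite -/iD hi0.
have eD iDelta : sDelta s = diagc (HC R N *m v) *m conjv iDelta <-> iDelta = iD.
  by apply: conj_quotP => k; case: (hv k).
have eY i iDelta :
    diagc ((HC R N)^T *m conjv iDelta) *m v + sY s = diagc v *m conjv i <->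
    i = conj_quot (sY s) v + (HC R N)^T *m iDelta.
  (* As H is real, conjugation passes through it, and the wye equation becomes s^Y = diag(v) conj(i
     - h), an instance of [conj_quotP]. *)
  rewrite HC_tr -conjv_real_mul diagc_mulC.
  set h := complex_mx _ *m iDelta.
  have [e1 e2] := @conj_quotP _ (sY s) v (i - h) (fun k => proj1 (hv k)).
  rewrite conjvB mulmxBr in e1 e2; split=> [e|e].
    by rewrite -e1 ?subrK// -e addrC addKr.
  by rewrite addrC e2 ?subrK// e addrK.
split=> [[i [iDelta [e1 e2 e3]]]|e].
  by move/eD: e2 e1 => -> /eY; rewrite -/i0 => <-; apply/uE.
by exists i0, iD; split; [apply/(eY _ _).2|apply/(eD _).2|apply/(uE _).2].
Qed.

(** The triangle inequality in each row, with L = |H|; it makes L|w| the natural weight for Hv when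
    |w| is the weight for [v]. *)
Lemma normc_HC_mul_le (w d : 'cV[R[i]]_(3 * N)) (t : R) :
  (forall j, nc (d j ord0) <= t * absv w j ord0) ->
  forall j, nc ((HC R N *m d) j ord0) <= t * (L_mx R N *m absv w) j ord0.
Proof.
move=> hd j; rewrite !mxE mulr_sumr; apply: le_trans (normc_sum _) _.
apply: ler_sum => k _; rewrite Normc.normcM !mxE normc_real mulrCA.
by apply: ler_wpM2l => //; have := hd k; rewrite mxE.
Qed.

End LoadFlow.

(** * Perturbation bounds for the fixed-point map *)

Section Xi.
Variables (R : realType) (N : nat) (Y : 'M[R[i]]_(3 + 3 * N)).
Variable v0 : 'cV[R[i]]_3.
Implicit Types (s : 'cV[R[i]]_(3 * N + 3 * N)) (f x y : 'cV[R[i]]_(3 * N)).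

Let w := zero_load Y v0.
Let Lw := L_abs_w Y v0.
Let Z := invmx (Y_LL Y).
Let ZH := Z *m (HC R N)^T.

Hypothesis w0 : forall j, w j ord0 != 0.
Hypothesis Lw0 : forall j, 0 < Lw j ord0.

Let absw_gt0 j : 0 < nc (w j ord0). Proof. by rewrite normc_gt0. Qed.

Lemma xiY_le s f t : 0 <= t ->
  (forall k, nc (f k ord0) <= t / nc (w k ord0) * nc (sY s k ord0)) ->
  forall j, nc ((Z *m f) j ord0) <= t * xiY Y v0 s * nc (w j ord0).
Proof. by move=> t0 hf; exact: normc_mulmx_le. Qed.

Lemma xiDelta_le s f t : 0 <= t ->
  (forall k, nc (f k ord0) <= t / Lw k ord0 * nc (sDelta s k ord0)) ->
  forall j, nc ((ZH *m f) j ord0) <= t * xiDelta Y v0 s * nc (w j ord0).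
Proof.
move=> t0 hf j; have cE k : nc (complex_mx Lw k ord0) = Lw k ord0.
  by rewrite mxE normc_real gtr0_norm.
rewrite /xiDelta -[invmx (diagc _) *m _ *m _]mulmxA; apply: normc_mulmx_le => // k.
  by rewrite -normc_gt0 cE.
by rewrite cE.
Qed.

Lemma xi_ge0 s : 0 <= xiY Y v0 s /\ 0 <= xiDelta Y v0 s.
Proof. by split; exact: norm_oo_ge0. Qed.

Lemma wballH x y t : wball (fun j => nc (w j ord0)) y t x ->
  wball (fun j => Lw j ord0) (HC R N *m y) t (HC R N *m x).
Proof.
move=> h j; rewrite -mulmxBr; apply: normc_HC_mul_le => k.
by rewrite [absv _ _ _]mxE; exact: h.
Qed.

(** The constants stay free, to cover both [vhat], with alpha and beta, and the points of the ball,
    with alpha - rho and beta - rho. *)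
Definition bounded_below (a b : R) x := forall j,
  a * nc (w j ord0) <= nc (x j ord0) /\
  b * Lw j ord0 <= nc ((HC R N *m x) j ord0).

Lemma bounded_below_wball a b t x y : bounded_below a b y ->
  wball (fun j => nc (w j ord0)) y t x -> bounded_below (a - t) (b - t) x.
Proof.
move=> hy hx j; have [ya yb] := hy j.
have sub (z z' : R[i]) (e e' : R) :
    e <= nc z -> nc (z' - z) <= e' -> e - e' <= nc z'.
  move=> ez zz; rewrite lerBlDr; apply: le_trans ez _.
  rewrite -{1}[z](subrK z') addrC; apply: le_trans (normcD _ _) _.
  by rewrite lerD2l normc_distC.
rewrite !mulrBl; split; apply: sub; [exact: ya| |exact: yb|].
  by have := hx j; rewrite !mxE.
by have := wballH hx j; rewrite colvB.
Qed.

Lemma bounded_below_G_defined a b x : 0 < a -> 0 < b ->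
  bounded_below a b x -> G_defined x.
Proof.
move=> a0 b0 h j; have [ha hb] := h j; rewrite -!normc_gt0; split.
  by apply: lt_le_trans ha; rewrite mulr_gt0.
by apply: lt_le_trans hb; rewrite mulr_gt0.
Qed.

(** Separate constants for [x] and [y] serve two uses: two points of the ball for the contraction
    factor, and a point of the ball against [vhat] for the self-map estimate. *)
Lemma G_map_lipschitz s a b a' b' t x y :
  0 < a -> 0 < b -> 0 < a' -> 0 < b' -> 0 <= t ->
  bounded_below a b x -> bounded_below a' b' y ->
  wball (fun j => nc (w j ord0)) y t x ->
  wball (fun j => nc (w j ord0)) (G_map Y v0 s y)
    (t / (a * a') * xiY Y v0 s + t / (b * b') * xiDelta Y v0 s) (G_map Y v0 s x).
Proof.
move=> a0 b0 a'0 b'0 t0 hx hy hxy j.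
rewrite !G_mapE; try exact: bounded_below_G_defined hx || exact: bounded_below_G_defined hy.
rewrite -/Z -/ZH.
have -> (u p q p' q' : 'cV[R[i]]_(3 * N)) :
    u + p + q - (u + p' + q') = (p - p') + (q - q').
  by apply/colP => k; rewrite !mxE; ring.
rewrite -!mulmxBr mxE mulrDl; apply: le_trans (normcD _ _) (lerD _ _).
  apply: xiY_le => [|k]; first by rewrite divr_ge0// mulr_ge0 ?ltW.
  rewrite colvB ![conj_quot _ _ _ _]mxE.
  apply: normc_conj_divB_le => //; [exact: (hx k).1|exact: (hy k).1|].
  by rewrite -colvB; exact: hxy.
apply: xiDelta_le => [|k]; first by rewrite divr_ge0// mulr_ge0 ?ltW.
rewrite colvB ![conj_quot _ _ _ _]mxE.
apply: normc_conj_divB_le => //; [exact: (hx k).2|exact: (hy k).2|].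
by rewrite -colvB; exact: wballH.
Qed.

(** At a fixed voltage, [conj_quot] is additive in the injection, so only [s - s'] enters. *)
Lemma G_map_sub_injection s s' a b x : 0 < a -> 0 < b -> bounded_below a b x ->
  wball (fun j => nc (w j ord0)) (G_map Y v0 s' x)
    (a^-1 * xiY Y v0 (s - s') + b^-1 * xiDelta Y v0 (s - s')) (G_map Y v0 s x).
Proof.
move=> a0 b0 hx j; rewrite !G_mapE; try exact: bounded_below_G_defined hx.
rewrite -/Z -/ZH.
have -> (u p q p' q' : 'cV[R[i]]_(3 * N)) :
    u + p + q - (u + p' + q') = (p - p') + (q - q').
  by apply/colP => k; rewrite !mxE; ring.
have quotB (c d y : 'cV[R[i]]_(3 * N)) :
    conj_quot c y - conj_quot d y = conj_quot (c - d) y.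
  by apply/colP => k; rewrite !mxE mulrBl rmorphB.
rewrite -!mulmxBr !quotB mxE mulrDl; apply: le_trans (normcD _ _) (lerD _ _).
  apply: xiY_le => [|k]; first by rewrite invr_ge0 ltW.
  rewrite mxE /sY linearB; apply: normc_conj_div_le => //; exact: (hx k).1.
apply: xiDelta_le => [|k]; first by rewrite invr_ge0 ltW.
rewrite mxE /sDelta linearB; apply: normc_conj_div_le => //; exact: (hx k).2.
Qed.

End Xi.

(** * Existence, uniqueness and convergence of the iteration *)

Theorem theorem1 (R : realType) (N : nat) (hN : (1 <= N)%N)
    (Y : 'M[R[i]]_(3 + 3 * N)) (v0 : 'cV[R[i]]_3)
    (hYLL : Y_LL Y \in unitmx)
    (hw : forall j, zero_load Y v0 j ord0 != 0)
    (vhat : 'cV[R[i]]_(3 * N)) (shat : 'cV[R[i]]_(3 * N + 3 * N))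
    (hvhat : load_flow Y v0 shat vhat)
    (s : 'cV[R[i]]_(3 * N + 3 * N))
    (rho : R) (hrho : 0 < rho < gamma Y v0 vhat)
    (hself :
      (xiY Y v0 (s - shat) + xiY Y v0 shat / alpha Y v0 vhat * rho)
        / (alpha Y v0 vhat - rho)
      + (xiDelta Y v0 (s - shat) + xiDelta Y v0 shat / beta Y v0 vhat * rho)
        / (beta Y v0 vhat - rho)
      <= rho)
    (hcontr :
      xiY Y v0 s / (alpha Y v0 vhat - rho) ^+ 2
      + xiDelta Y v0 s / (beta Y v0 vhat - rho) ^+ 2 < 1) :
  exists v : 'cV[R[i]]_(3 * N),
    unique (fun v' => D_set Y v0 rho vhat v' /\ load_flow Y v0 s v') v /\
    (forall x : 'cV[R[i]]_(3 * N), D_set Y v0 rho vhat x ->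
      (forall k, G_defined (iter k (G_map Y v0 s) x)) /\
      cvg_vec (fun k => iter k (G_map Y v0 s) x) v).
Proof.
move: hrho hself hcontr; rewrite /gamma lt_min.
set a := alpha Y v0 vhat; set b := beta Y v0 vhat.
move=> /and3P[rho0 rho_a rho_b] hself hcontr.
have [a0 b0] : 0 < a /\ 0 < b by split; exact: lt_trans rho0 _.
have [ar0 br0] : 0 < a - rho /\ 0 < b - rho by rewrite !subr_gt0.
(* Excludes the default value of [min_index], so that alpha and beta are true minima. *)
have N0 : (0 < 3 * N)%N by rewrite muln_gt0.
set w := zero_load Y v0; set Lw := L_abs_w Y v0.
pose c (j : 'I_(3 * N)) := nc (w j ord0).
have c0 j : 0 < c j by rewrite normc_gt0.
have ha j : a <= nc (vhat j ord0) / c j.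
  have [+ _] := min_indexP (fun j => absv vhat j ord0 / absv w j ord0) N0.
  by move=> /(_ j); rewrite ![absv _ _ _]mxE.
have hb j : b <= nc ((HC R N *m vhat) j ord0) / Lw j ord0.
  have [+ _] := min_indexP (fun j => absv (HC R N *m vhat) j ord0 / Lw j ord0) N0.
  by move=> /(_ j); rewrite [absv _ _ _]mxE.
(* Follows from beta > 0: a nonpositive denominator, including 0 with its inverse 0, would make the
   quotient in [hb] nonpositive. *)
have Lw0 j : 0 < Lw j ord0.
  rewrite ltNge; apply/negP => Lw_le0; have := lt_le_trans b0 (hb j).
  by rewrite ltNge mulr_ge0_le0// ?normc_ge0// invr_le0.
have hvhat_below : bounded_below Y v0 a b vhat.
  by move=> j; rewrite -!ler_pdivlMr ?c0.
have DE v : D_set Y v0 rho vhat v <-> wball c vhat rho v.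
  by split=> h j; have := h j; rewrite ![absv _ _ _]mxE.
have below v : wball c vhat rho v -> bounded_below Y v0 (a - rho) (b - rho) v.
  exact: bounded_below_wball hvhat_below.
have Gdef v : wball c vhat rho v -> G_defined v.
  by move/below; exact: bounded_below_G_defined.
have Gvhat : G_map Y v0 shat vhat = vhat.
  by apply/load_flow_fixed_point => //; exact: bounded_below_G_defined hvhat_below.
have [xY0 xD0] := xi_ge0 Y v0 s.
have inj v (hv : wball c vhat rho v) :=
  G_map_sub_injection hw Lw0 s shat ar0 br0 (below _ hv).
have lip_hat v (hv : wball c vhat rho v) :=
  G_map_lipschitz hw Lw0 shat ar0 br0 a0 b0 (ltW rho0) (below _ hv)
    hvhat_below hv.
have lip t u v (hu : wball c vhat rho u) (hv : wball c vhat rho v) (t0 : 0 <= t) :=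
  G_map_lipschitz hw Lw0 s ar0 br0 ar0 br0 t0 (below _ hu) (below _ hv).
rewrite Gvhat -/w -/c in inj lip_hat lip.
clear ha hb hvhat_below below.
move: (xiY Y v0 s) (xiDelta Y v0 s) (xiY Y v0 shat) (xiDelta Y v0 shat)
  (xiY Y v0 (s - shat)) (xiDelta Y v0 (s - shat))
  hself hcontr xY0 xD0 inj lip_hat lip => xY xD hY hD dY dD.
clearbody a b => hself hcontr xY0 xD0 inj lip_hat lip.
set q := _ + _ in hcontr.
have q01 : 0 <= q < 1.
  by rewrite hcontr andbT addr_ge0// divr_ge0// exprn_ge0// ltW.
(* The constants of [inj] and [lip_hat] add up exactly to the left-hand side of [hself]. *)
have self v : wball c vhat rho v -> wball c vhat rho (G_map Y v0 s v).
  move=> hv j; apply: le_trans (wball_trans (inj _ hv) (lip_hat _ hv) j) _.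
  apply: ler_wpM2r; first exact: ltW (c0 j).
  apply: le_trans hself; rewrite le_eqVlt; apply/orP; left; apply/eqP.
  by field; rewrite !gt_eqF.
have {}lip t u v : wball c vhat rho u -> wball c vhat rho v -> 0 <= t ->
    wball c v t u -> wball c (G_map Y v0 s v) (q * t) (G_map Y v0 s u).
  move=> hu hv t0 huv; have -> : q * t =
      t / ((a - rho) * (a - rho)) * xY + t / ((b - rho) * (b - rho)) * xD.
    by rewrite /q; field; rewrite !gt_eqF.
  exact: lip.
have [v [Dv Gv hit]] :=
  weighted_contraction (fun j => ltW (c0 j)) (ltW rho0) q01 self lip.
exists v; split; first split.
- by split; [exact/DE|apply/load_flow_fixed_point => //; exact: Gdef].
(* A second solution [u] is its own orbit, hence within [q ^+ k * (2 * rho)] of [v] for all [k]. *)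
- move=> u [/DE Du]; rewrite load_flow_fixed_point// => [Gu|]; last exact: Gdef.
  apply/esym/(@wball0 _ _ c).
  apply: (@le_wball_geometric _ _ c q q01 _ _ _ (2 * rho)) => k.
  rewrite add0r -[u](iter_fix k Gu); exact: hit.
(* Every iterate stays in the ball, where the denominators of [G_map] do not vanish. *)
- move=> x /DE Dx; split=> [k|]; first by apply: Gdef; exact: wball_iter.
  by apply: (geometric_cvg_vec q01) => k; exact: hit.
Qed.
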